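(* Let $B$ be a finite left regular band. The following are equivalent: (1) $B$ is connected; (2) the semigroup ring $\mathbb{Z}B$ has a multiplicative identity; (3) the semigroup algebra $\Bbbk B$ has a multiplicative identity for every commutative ring with unit $\Bbbk$.
   Context: A left regular band is a semigroup $B$ satisfying $x^2=x$ and $xyx=xy$ for all $x,y$. It is partially ordered by $a\le b$ iff $ba=a$. Its support semilattice is $\Lambda(B)=\{Bb\mid b\in B\}$, ordered by inclusion (with $Ba\cap Bb=Bab$); for $X\in\Lambda(B)$ the contraction is $B_{\ge X}=\{b\in B\mid Bb\supseteq X\}$, a subsemigroup. The order complex $\Delta(P)$ of a poset $P$ is the simplicial complex whose simplices are the nonempty finite chains of $P$. $B$ is called connected if $\Delta(B_{\ge X})$ is connected for every $X\in\Lambda(B)$. *)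

(* Defs.v *)
From HB Require Import structures.
From mathcomp Require Import all_boot all_order all_algebra.
From mathcomp Require Import all_classical all_reals all_analysis.
Set Implicit Arguments.
Unset Strict Implicit.
Unset Printing Implicit Defensive.
Import Order.TTheory GRing.Theory Num.Theory.
Import numFieldNormedType.Exports.

Local Open Scope ring_scope.

#[short(type="finSemigroupType")]
HB.structure Definition FinSemigroup := {S of Semigroup S & Finite S}.

HB.mixin Record isLeftRegularBand B of Semigroup B := {
  lrb_mulxx : forall x : B, (x * x)%g = x;
  lrb_mulxyx : forall x y : B, (x * y * x)%g = (x * y)%g
}.

#[short(type="finLRBType")]
HB.structure Definition FinLeftRegularBand :=
  {B of isLeftRegularBand B & FinSemigroup B}.

(* The alias carrying the order a <= b iff b * a = a. *)
Definition lrb_order (B : finLRBType) : Type := B.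
HB.instance Definition _ (B : finLRBType) := Finite.on (lrb_order B).

Fact lrb_display : Order.disp_t. Proof. exact: Order.Disp tt tt. Qed.

Section LeftRegularBand.
Variable B : finLRBType.
Implicit Types (a b : B) (X : {set B}).

Definition lrb_le a b : bool := (b * a)%g == a.

Fact lrb_le_refl : reflexive lrb_le.
Proof. by move=> a; rewrite /lrb_le lrb_mulxx. Qed.

Fact lrb_le_anti : antisymmetric lrb_le.
Proof.
move=> a b /andP[/eqP ba /eqP ab].
by have := lrb_mulxyx a b; rewrite ab ba.
Qed.

Fact lrb_le_trans : transitive lrb_le.
Proof.
by move=> b a c /eqP ba /eqP cb; apply/eqP; rewrite -ba mulgA cb.
Qed.

HB.instance Definition _ :=
  Order.Le_isPOrder.Build lrb_display (lrb_order B)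
    lrb_le_refl lrb_le_anti lrb_le_trans.

Definition left_ideal b : {set B} := [set (a * b)%g | a in [set: B]]%SET.

Definition support_semilattice : {set {set B}} :=
  [set left_ideal b | b in [set: B]]%SET.

Definition lrb_contraction X : {set B} := [set b | X \subset left_ideal b]%SET.

End LeftRegularBand.

(* The order complex of the subposet A of P. *)
Definition order_complex d (P : finPOrderType d) (A : {set P}) : {set {set P}} :=
  [set s | [&& s != finset.set0, s \subset A
             & [forall x in s, forall y in s, x >=< y]%O]]%SET.

(* The geometric realization of a finite simplicial complex K (given as its set
   of simplices) in barycentric coordinates; since V is finite, the product
   topology on V -> R is the Euclidean one. *)
Definition realization (R : realType) (V : finType) (K : {set {set V}}) :
    set {ptws V -> R} :=
  [set x : {ptws V -> R} |
    [/\ forall v, 0 <= x v,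
        \sum_(v : V) x v = 1
      & [set v | x v != 0]%SET \in K]]%classic.
Arguments realization R {V} K.

Definition lrb_connected (R : realType) (B : finLRBType) : Prop :=
  forall X : {set B}, X \in support_semilattice B ->
    connected
      (realization R (order_complex (lrb_contraction X : {set lrb_order B}))).

Section SemigroupAlgebra.
Variables (k : pzRingType) (S : finSemigroupType).

(* f stands for the formal sum \sum_a f a * a. *)
Definition semigroup_algebra : Type := {ffun S -> k}.

Definition sgalg_mul (f g : semigroup_algebra) : semigroup_algebra :=
  [ffun c => \sum_(p : S * S | (p.1 * p.2)%g == c) f p.1 * g p.2].

Definition has_mul_identity : Prop :=
  exists e : semigroup_algebra, left_id e sgalg_mul /\ right_id e sgalg_mul.

End SemigroupAlgebra.

(* Main.v *)
Require Import Defs.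
From mathcomp Require Import all_boot all_order all_algebra.
From mathcomp Require Import all_classical all_reals all_analysis.
Set Implicit Arguments.
Unset Strict Implicit.
Unset Printing Implicit Defensive.
Import Order.TTheory GRing.Theory Num.Theory.
Import numFieldNormedType.Exports.

(* kB always has a right identity e, so the question is whether w_b := e b - b
   vanishes.  If f is a left identity, the total coefficient of f b = b on a
   comparability component of B_{>= X} does not depend on b, because a b <= a;
   so there is only one component.  Conversely, show that the coefficient of w_b
   at c vanishes by descending induction on the support X = Bc: the inductive
   hypothesis gives w_{ab}(c) = w_a(c) for b in B_{>= X}, so a |-> w_a(c) is
   constant on the comparability components of B_{>= X}, hence constant, and its
   value is 0 since e e = e and the coefficients of e sum to 1 on B_{>= X}. *)

Local Open Scope ring_scope.

(** * Linear extension of self-maps to formal sums *)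

Section Pushforward.
Variables (k : pzRingType) (S : finType).
Implicit Types (f g : S -> S) (u v : {ffun S -> k}).

Definition dirac_ffun (b : S) : {ffun S -> k} := [ffun c => (b == c)%:R].

(** The linear extension of [f]. For [f] a left or right translation by [b], it is multiplication of
    the formal sum by the basis element [b] on that side. *)
Definition pushforward_ffun f u : {ffun S -> k} :=
  [ffun c => \sum_(a | f a == c) u a].

Lemma pushforward_ffunD f u v :
  pushforward_ffun f (u + v) = pushforward_ffun f u + pushforward_ffun f v.
Proof.
apply/ffunP => c; rewrite !ffunE -big_split.
by apply: eq_bigr => a _; rewrite ffunE.
Qed.

Lemma pushforward_ffunB f u v :
  pushforward_ffun f (u - v) = pushforward_ffun f u - pushforward_ffun f v.
Proof.
apply/ffunP => c; rewrite !ffunE -sumrB.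
by apply: eq_bigr => a _; rewrite !ffunE.
Qed.

Lemma pushforward_ffun_dirac f b :
  pushforward_ffun f (dirac_ffun b) = dirac_ffun (f b).
Proof.
apply/ffunP => c; rewrite !ffunE.
under eq_bigr do rewrite ffunE eq_sym.
have [<-|ne] := eqVneq (f b) c.
  by rewrite (bigD1 b) //= eqxx big1 ?addr0 // => i /andP[_ /negPf ->].
by rewrite big1 // => a /eqP fa; case: eqP => // ab; rewrite -fa ab eqxx in ne.
Qed.

Lemma pushforward_ffun_comp f g u :
  pushforward_ffun f (pushforward_ffun g u) = pushforward_ffun (f \o g) u.
Proof.
apply/ffunP => c; rewrite !ffunE.
under eq_bigr do rewrite ffunE.
rewrite (exchange_big_dep (fun a => f (g a) == c)) /=.
  apply: eq_bigr => a /eqP fga; rewrite (big_pred1 (g a)) // => b /=.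
  by rewrite [RHS]eq_sym andbC; case: eqP => //= <-; rewrite fga eqxx.
by move=> b a /eqP <- /eqP ->.
Qed.

Lemma eq_pushforward_ffun f g u :
  f =1 g -> pushforward_ffun f u = pushforward_ffun g u.
Proof.
by move=> fg; apply/ffunP => c; rewrite !ffunE; apply: eq_bigl => a; rewrite fg.
Qed.

End Pushforward.

(** * One-sided identities tested on basis elements *)

Section Identities.
Variables (k : pzRingType) (S : finSemigroupType).
Implicit Types u v : semigroup_algebra k S.

Lemma sgalg_mulEl u v c :
  sgalg_mul u v c = \sum_a u a * pushforward_ffun ( *%g a) v c.
Proof.
rewrite !ffunE; under [RHS]eq_bigr do rewrite ffunE big_distrr.
by rewrite pair_big_dep; apply: eq_bigl => -[].
Qed.

Lemma sgalg_mulEr u v c :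
  sgalg_mul u v c = \sum_b pushforward_ffun ( *%g^~ b) u c * v b.
Proof.
rewrite !ffunE; under [RHS]eq_bigr do rewrite ffunE big_distrl.
by rewrite (exchange_big_dep predT) //= pair_big_dep; apply: eq_bigl => -[].
Qed.

Lemma sum_mul_dirac (F : S -> k) (c : S) :
  \sum_b F b * dirac_ffun k b c = F c.
Proof.
rewrite (bigD1 c) //= ffunE eqxx mulr1 big1 ?addr0 // => b /negPf bc.
by rewrite ffunE bc mulr0.
Qed.

Lemma sum_dirac_mul (F : S -> k) (c : S) :
  \sum_b dirac_ffun k b c * F b = F c.
Proof.
rewrite (bigD1 c) //= ffunE eqxx mul1r big1 ?addr0 // => b /negPf bc.
by rewrite ffunE bc mul0r.
Qed.

(** The product of [u] and [v] is the combination of the products of [u] with basis elements [b],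
    with coefficients [v b]. *)
Lemma sgalg_left_idP u :
  left_id u (@sgalg_mul k S) <->
  forall b, pushforward_ffun ( *%g^~ b) u = dirac_ffun k b.
Proof.
split=> [ul b | ul v]; apply/ffunP => c.
  rewrite -[in RHS](ul (dirac_ffun k b)) sgalg_mulEr.
  under eq_bigr do rewrite [dirac_ffun k b _]ffunE eq_sym.
  rewrite (bigD1 b) //= eqxx mulr1 big1 ?addr0 // => a /negPf ->.
  by rewrite mulr0.
by rewrite sgalg_mulEr; under eq_bigr do rewrite ul; rewrite sum_dirac_mul.
Qed.

Lemma sgalg_right_id u :
  (forall b, pushforward_ffun ( *%g b) u = dirac_ffun k b) ->
  right_id u (@sgalg_mul k S).
Proof.
move=> ur v; apply/ffunP => c.
by rewrite sgalg_mulEl; under eq_bigr do rewrite ur; rewrite sum_mul_dirac.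
Qed.

End Identities.

(** * Identities and comparability components in a left regular band *)

Section LeftRegularBand.
Variable B : finLRBType.
Implicit Types a b c d : B.

Lemma lrb_contractionE c b :
  (b \in lrb_contraction (left_ideal c)) = ((c * b)%g == c).
Proof.
rewrite inE; apply/fintype.subsetP/eqP => [/(_ c)|cb x].
  case/(_ _)/imsetP; first by apply/imsetP; exists c; rewrite ?lrb_mulxx.
  by move=> a _ ->; rewrite -mulgA lrb_mulxx.
case/imsetP => a _ ->; apply/imsetP; exists (a * c)%g => //.
by rewrite -mulgA cb.
Qed.

(* In the unitization, this is 1 - \prod_b (1 - b): each b is killed by the
   product because b (1 - x_1) ... (1 - x_m) (1 - b) = 0, as b x b = b x. *)
Lemma lrb_right_identity (k : pzRingType) : exists e : {ffun B -> k},
  forall b, pushforward_ffun ( *%g b) e = dirac_ffun k b.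
Proof.
suff [e ee] : exists e : {ffun B -> k}, forall b, b \in enum B ->
    pushforward_ffun ( *%g b) e = dirac_ffun k b.
  by exists e => b; apply: ee; rewrite mem_enum.
elim: (enum B) => [|x s [e ee]]; first by exists 0.
(* This is 1 - (1 - e)(1 - x), expanded. *)
exists (e + dirac_ffun k x - pushforward_ffun ( *%g^~ x) e) => b.
rewrite pushforward_ffunB pushforward_ffunD pushforward_ffun_dirac.
rewrite pushforward_ffun_comp inE => /orP[/eqP ->|bs].
  rewrite lrb_mulxx [X in _ - X](@eq_pushforward_ffun _ _ _ ( *%g x)).
    by rewrite addrAC subrr add0r.
  by move=> a /=; rewrite mulgA lrb_mulxyx.
rewrite [X in _ - X](@eq_pushforward_ffun _ _ _ ( *%g^~ x \o *%g b)).
  rewrite -(pushforward_ffun_comp ( *%g^~ x)) ee //.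
  by rewrite pushforward_ffun_dirac addrK.
by move=> a /=; rewrite mulgA.
Qed.

(** The predicate [p] encodes a union of comparability components of the contraction at Bc. The
    coefficients of [e] on it sum to [(p b)%:R] for every [b] of the contraction, and 1 differs from
    0 in [k]. *)
Lemma left_identity_connected (k : nzRingType) (e : {ffun B -> k}) (c : B)
    (p : pred B) :
    (forall b, pushforward_ffun ( *%g^~ b) e = dirac_ffun k b) ->
    (forall a b, (c * a)%g = c -> (c * b)%g = c -> (b * a)%g = a ->
       p a = p b) ->
  forall a b, (c * a)%g = c -> (c * b)%g = c -> p a = p b.
Proof.
move=> el pinv.
have tot b : (c * b)%g = c ->
    \sum_(a | ((c * a)%g == c) && p a) e a = (p b)%:R.
  move=> cb.
  (* Write [b] as e b: the term of [e] at [a] moves to [a * b], which lies below [a], so [p] takes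
     the same value at both. *)
  transitivity (\sum_(d | ((c * d)%g == c) && p d) dirac_ffun k b d).
    rewrite -el; under [RHS]eq_bigr do rewrite ffunE.
    rewrite (exchange_big_dep predT) //= [LHS]big_mkcond; apply: eq_bigr => a _.
    have cab : ((c * (a * b))%g == c) = ((c * a)%g == c).
      rewrite mulgA; apply/eqP/eqP => [cab|->//].
      have : (c * (a * b * a) = c * (a * b))%g by rewrite lrb_mulxyx.
      by rewrite !mulgA cab.
    case: ifPn => [/andP[/eqP ca pa]|npa]; last first.
      rewrite big1 // => d /andP[/andP[cd pd] /eqP abd].
      move: npa; rewrite -cab abd cd /= => /negP[].
      have ca : (c * a)%g = c by apply/eqP; rewrite -cab abd.
      rewrite -(pinv d a) //; first exact/eqP.
      by rewrite -abd mulgA lrb_mulxx.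
    rewrite (big_pred1 (a * b)%g) // => d /=.
    rewrite [RHS]eq_sym andbC; case: eqP => //= <-.
    rewrite cab ca eqxx /= (pinv _ a) // ?pa // ?mulgA ?ca ?lrb_mulxx //.
  rewrite big_mkcond (bigD1 b) //= cb eqxx /= ffunE eqxx big1 ?addr0.
    by case: (p b).
  by move=> d /negPf db; rewrite ffunE (eq_sym b) db; case: ifP.
move=> a b ca cb; have := tot a ca; rewrite (tot b cb).
by case: (p a) (p b) => -[] //= /eqP; rewrite ?oner_eq0 // eq_sym oner_eq0.
Qed.

Lemma connected_left_identity (k : pzRingType) (e : {ffun B -> k}) :
    (forall c (p : pred B),
       (forall a b, (c * a)%g = c -> (c * b)%g = c -> (b * a)%g = a ->
          p a = p b) ->
     forall a b, (c * a)%g = c -> (c * b)%g = c -> p a = p b) ->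
    (forall b, pushforward_ffun ( *%g b) e = dirac_ffun k b) ->
  forall b, pushforward_ffun ( *%g^~ b) e = dirac_ffun k b.
Proof.
move=> conn er.
pose w b := pushforward_ffun ( *%g^~ b) e - dirac_ffun k b.
have wM a b : w (a * b)%g = pushforward_ffun ( *%g^~ b) (w a).
  rewrite pushforward_ffunB pushforward_ffun_dirac pushforward_ffun_comp.
  by congr (_ - _); apply: eq_pushforward_ffun => x /=; rewrite mulgA.
(* The sum is the coefficient of e e - e at [c], and [e] is a right identity. *)
have ew c : \sum_b w b c * e b = 0.
  under eq_bigr do rewrite !ffunE mulrBl.
  rewrite sumrB; apply/eqP; rewrite subr_eq0; apply/eqP.
  transitivity (sgalg_mul (e : semigroup_algebra k B) e c).
    by rewrite sgalg_mulEr; apply: eq_bigr => b _; rewrite ffunE.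
  rewrite sgalg_right_id // -[LHS]sum_dirac_mul.
  by apply: eq_bigr => b _; rewrite ffunE.
suff w0 c b : w b c = 0.
  move=> b; apply/eqP; rewrite -subr_eq0; apply/eqP/ffunP => c.
  by rewrite w0 ffunE.
(* Induct on the size of the contraction at Bc, which shrinks as the support grows. *)
have [n] := ubnP #|[set b | (c * b)%g == c]|.
elim: n => // n IHn in c b *; rewrite ltnS => cn.
have w0 a : (c * a)%g != c -> w a c = 0.
  move=> ca; rewrite !ffunE big1 => [|x /eqP xa].
    have [ac|_] := eqVneq a c; last by rewrite subr0.
    by rewrite ac lrb_mulxx eqxx in ca.
  by case/eqP: ca; rewrite -xa -mulgA lrb_mulxx.
(* The left side sums [w a d] over [d * x = c]. Each such [d] other than [c] has support strictly
   above Bc, so the induction hypothesis kills its term. *)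
have wr a x : (c * x)%g = c -> w (a * x)%g c = w a c.
  move=> cx; rewrite wM ffunE (bigD1 c) /= ?cx // big1 ?addr0 //.
  move=> d /andP[/eqP dx dc].
  have cd : (c * d)%g = c by rewrite -dx lrb_mulxyx.
  apply: IHn; apply: leq_trans cn; apply: proper_card.
  apply/properP; split.
    apply/fintype.subsetP => y; rewrite !inE => /eqP dy.
    by rewrite -{1}cd -mulgA dy cd.
  exists c; first by rewrite inE lrb_mulxx.
  by rewrite inE -dx mulgA lrb_mulxx dx eq_sym.
have [/eqP cb|/w0//] := boolP ((c * b)%g == c).
have wc a : (c * a)%g = c -> w a c = w b c.
  move=> ca; apply/eqP.
  rewrite (conn c (fun x => w x c == w b c) _ _ b) //.
  by move=> x y cx cy yx; rewrite -yx wr.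
have := ew c; rewrite (bigID (fun a => (c * a)%g == c)) /=.
rewrite [X in _ + X]big1 ?addr0; last by move=> a /w0 ->; rewrite mul0r.
under eq_bigr => a /eqP ca do rewrite wc //.
rewrite -big_distrr /=.
(* The remaining factor, the sum of [e a] over [c * a = c], is the coefficient of c e = c at [c],
   hence 1. *)
by have /ffunP/(_ c) := er c; rewrite !ffunE eqxx => ->; rewrite mulr1.
Qed.

End LeftRegularBand.

(** * Connectedness of the realization of an order complex *)

Lemma continuous_ptws (T U : topologicalType) (V : Type)
    (f : T -> {ptws V -> U}) :
  (forall v, continuous (f^~ v)) -> continuous f.
Proof.
move=> fc t; apply/cvg_sup => v W [_ [[V1 oV1 <-] V1ft] V1W].
apply: (filterS V1W); apply: (fc v t).
exact: open_nbhs_nbhs.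
Qed.

Section Realization.
Variables (R : realType) (d : Order.disp_t) (P : finPOrderType d) (A : {set P}).
Local Notation K := (order_complex A).

Lemma order_complexS s t :
  s \in K -> t != finset.set0 -> t \subset s -> t \in K.
Proof.
rewrite !inE => /and3P[_ sA /forallP ch] -> ts /=.
rewrite (fintype.subset_trans ts sA) /=.
apply/forall_inP => x /(fintype.subsetP ts) xs.
apply/forall_inP => y /(fintype.subsetP ts) ys.
by have /implyP/(_ xs)/forall_inP/(_ y ys) := ch x.
Qed.

Definition vertex (v : P) : {ptws P -> R} := fun w => (v == w)%:R.

Lemma sum_vertex v : \sum_w vertex v w = 1 :> R.
Proof.
rewrite (bigD1 v) //= /vertex eqxx big1 ?addr0 // => w /negPf.
by rewrite eq_sym => ->.
Qed.

Lemma vertex_realization v : v \in A -> realization R K (vertex v).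
Proof.
move=> vA; split=> [w||]; first by rewrite ler0n.
  exact: sum_vertex.
rewrite (_ : [set w | _]%SET = [set v]%SET); last first.
  by apply/setP => w; rewrite !inE /vertex pnatr_eq0 eqb0 negbK eq_sym.
rewrite inE finset.sub1set vA; apply/andP; split.
  by apply/finset.set0Pn; exists v; rewrite inE.
apply/forall_inP => x /set1P ->; apply/forall_inP => y /set1P ->.
by rewrite /Order.comparable lexx.
Qed.

(** The straight segment from [x] to [y] stays in the closed simplex [s]: its points have nonempty
    support inside [s]. *)
Lemma segment_component (x y : {ptws P -> R}) s : s \in K ->
    (forall v, 0 <= x v) -> \sum_v x v = 1 ->
    (forall v, 0 <= y v) -> \sum_v y v = 1 ->
    (forall v, v \notin s -> x v = 0 /\ y v = 0) ->
  connected_component (realization R K) x y.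
Proof.
move=> sK x0 x1 y0 y1 xys.
pose g (t : R) : {ptws P -> R} := fun v => x v + t * (y v - x v).
exists (g @` `[0, 1]%classic)%classic; last first.
  exists 1; first by rewrite /= in_itv /= ler01 lexx.
  by apply/funext => v; rewrite /g mul1r addrC subrK.
split.
- exists 0; first by rewrite /= in_itv /= ler01 lexx.
  by apply/funext => v; rewrite /g mul0r addr0.
- move=> _ [t /= + <-]; rewrite in_itv /= => /andP[t0 t1].
  have g0 v : 0 <= g t v.
    rewrite (_ : g t v = (1 - t) * x v + t * y v).
      by rewrite addr_ge0 // mulr_ge0 // subr_ge0.
    by rewrite /g mulrBr mulrBl mul1r addrA addrAC.
  have g1 : \sum_v g t v = 1.
    by rewrite big_split /= -big_distrr /= sumrB x1 y1 subrr mulr0 addr0.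
  split=> //; apply: (order_complexS sK).
    apply/eqP => /setP gt0; move: g1; rewrite big1 => [/eqP|v _].
      by rewrite eq_sym oner_eq0.
    by have := gt0 v; rewrite !inE => /negbFE/eqP.
  apply/fintype.subsetP => v; rewrite inE; apply: contraR => /xys[xv yv].
  by rewrite /g xv yv subrr mulr0 addr0.
- apply: connected_continuous_connected; first exact: segment_connected.
  apply: continuous_subspaceT; apply: continuous_ptws => v t.
  rewrite /g; apply: cvgD; first exact: cvg_cst.
  by apply: cvgM; [exact: cvg_id|exact: cvg_cst].
Qed.

(** An invariant [p] splits the realization into two clopen pieces according to the total weight on
    [p]. Conversely, each point is joined to a vertex of its support, and comparable vertices are
    joined by an edge. *)
Lemma connected_realizationP : connected (realization R K) <->
  forall p : pred P,
    (forall x y, x \in A -> y \in A -> (x <= y)%O -> p x = p y) ->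
    forall x y, x \in A -> y \in A -> p x = p y.
Proof.
split=> [conn p pinv|conn].
  pose g (x : {ptws P -> R}) : R := \sum_(v | p v) x v.
  have gc : continuous g.
    apply: continuous_big; first exact: add_continuous.
    move=> v _; exact: (@proj_continuous _ (fun=> R) v).
  (* The support of [x] is a chain, so [p] is constant on it and [g x] is 0 or 1. Any threshold
     strictly between them gives one set that is both open and closed. *)
  have g01 x : realization R K x -> (2^-1 < g x) = (2^-1 <= g x).
    move=> [x0 x1]; rewrite inE => /and3P[/finset.set0Pn[v]].
    rewrite inE => xv /fintype.subsetP xA /forallP ch.
    have pv w : x w != 0 -> p w = p v.
      move=> xw; have wA : w \in A by apply: xA; rewrite inE.
      have vA : v \in A by apply: xA; rewrite inE.
      have := ch v; rewrite inE xv /= => /forall_inP/(_ w).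
      rewrite inE => /(_ xw) /orP[vw|wv]; last exact: pinv.
      exact/esym/pinv.
    have [pvT|pvF] := boolP (p v).
      have -> : g x = 1.
        rewrite -x1 /g [LHS]big_mkcond; apply: eq_bigr => w _.
        by case: ifPn => // pw; apply/esym/eqP; apply: contraNT pw => /pv ->.
      by rewrite invf_lt1 ?ltr1n // ltW // invf_lt1 ?ltr1n.
    have -> : g x = 0.
      rewrite /g big1 // => w pw; apply/eqP; apply: contraNT pvF => /pv <- //.
    by rewrite ltNge invr_ge0 ler0n leNgt invr_gt0 ltr0n.
  suff main x y : x \in A -> y \in A -> p x -> p y.
    by move=> x y xA yA; apply/idP/idP; apply: main.
  move=> xA yA px.
  have gv z : g (vertex z) = (p z)%:R.
    rewrite /g big_mkcond (bigD1 z) //= {1}/vertex eqxx big1 ?addr0 /=.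
      by case: (p z).
    by move=> w /negPf wz; rewrite /vertex eq_sym wz; case: ifP.
  have := conn (realization R K `&` g @^-1` [set r | 2^-1 < r])%classic.
  case/(_ _ _ _)/seteqP.
  - exists (vertex x); split; first exact: vertex_realization.
    by rewrite /= gv px invf_lt1 ?ltr1n.
  - exists (g @^-1` [set r | 2^-1 < r])%classic => //.
    by apply: open_comp => [z _|]; [exact: gc|exact: open_gt].
  - exists (g @^-1` [set r | 2^-1 <= r])%classic.
      by apply: preimage_closed => [z _|]; [exact: gc|exact: closed_ge].
    by apply/seteqP; split=> z [Kz] /=; rewrite g01.
  move=> _ /(_ _ (vertex_realization yA)) [_ /=].
  by rewrite gv; case: (p y) => //; rewrite ltNge invr_ge0 ler0n.
have cv x v : realization R K x -> x v != 0 ->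
    connected_component (realization R K) (vertex v) x.
  move=> [x0 x1 xK] xv; apply: (segment_component xK) => //.
  - exact: sum_vertex.
  - move=> w; rewrite inE negbK => /eqP xw; split=> //.
    by rewrite /vertex; have [vw|//] := eqVneq v w; rewrite vw xw eqxx in xv.
have suppA x v : realization R K x -> x v != 0 -> v \in A.
  move=> [_ _]; rewrite inE => /and3P[_ /fintype.subsetP xA _] xv.
  by apply: xA; rewrite inE.
have [/eqP K0|/set0P[x Kx]] := boolP (realization R K == set0)%classic.
  by rewrite K0; exact: connected0.
have supp0 y : realization R K y -> exists v, y v != 0.
  move=> [_ _]; rewrite inE => /and3P[/finset.set0Pn[v]].
  by rewrite inE; exists v.
have [v xv] := supp0 _ Kx.
have vA := suppA _ _ Kx xv.
(* The hypothesis is applied to the set of vertices lying in the component of [v]. *)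
pose p w := `[< connected_component (realization R K) (vertex v) (vertex w) >].
have pv w : w \in A -> p w.
  move=> wA; rewrite -(conn p _ v w) //.
    apply/asboolP; apply: connected_component_refl.
    exact: vertex_realization.
  move=> y z yA zA yz.
  have yzc : connected_component (realization R K) (vertex y) (vertex z).
    apply: (@segment_component _ _ [set y; z]%SET) => //.
    - rewrite inE; apply/and3P; split.
      + by apply/finset.set0Pn; exists y; rewrite !inE eqxx.
      + by apply/fintype.subsetP => u; rewrite !inE => /orP[]/eqP->.
      + apply/forall_inP => u uyz; apply/forall_inP => u'.
        move: uyz; rewrite !inE => /orP[]/eqP-> /orP[]/eqP->;
          by rewrite /Order.comparable ?lexx ?yz ?orbT.
    - exact: sum_vertex.
    - exact: sum_vertex.
    - move=> u; rewrite !inE negb_or => /andP[/negPf uy /negPf uz].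
      by rewrite /vertex eq_sym uy eq_sym uz.
  apply/asboolP/asboolP => h; first exact: connected_component_trans yzc.
  exact/(connected_component_trans h)/connected_component_sym.
rewrite (_ : realization R K =
             connected_component (realization R K) (vertex v)).
  exact: component_connected.
apply/seteqP; split; last exact: connected_component_sub.
move=> y Ky; have [w yw] := supp0 _ Ky.
have /asboolP := pv w (suppA _ _ Ky yw).
by move=> /connected_component_trans; apply; exact: cv.
Qed.

End Realization.

(** * Translation to left regular bands and the equivalences *)

Section Connected.
Variable B : finLRBType.

Lemma lrb_connectedP (R : realType) : lrb_connected R B <->
  forall (c : B) (p : pred B),
    (forall a b, (c * a)%g = c -> (c * b)%g = c -> (b * a)%g = a ->
       p a = p b) ->
  forall a b, (c * a)%g = c -> (c * b)%g = c -> p a = p b.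
Proof.
split=> [conn c p pinv a b ca cb | conn X /imsetP[c _ ->]].
  have /conn/connected_realizationP/(_ p) :
    left_ideal c \in support_semilattice B by apply/imsetP; exists c.
  apply; rewrite ?lrb_contractionE ?ca ?cb // => x y.
  by rewrite !lrb_contractionE => /eqP cx /eqP cy /eqP; apply: pinv.
apply/connected_realizationP => p pinv a b.
rewrite !lrb_contractionE => /eqP ca /eqP cb.
apply: (conn c) => // x y cx cy yx.
by apply: pinv; rewrite ?lrb_contractionE ?cx ?cy //; exact/eqP.
Qed.

End Connected.

Theorem theorem4p15 (R : realType) (B : finLRBType) :
  (lrb_connected R B <-> has_mul_identity int B) /\
  (has_mul_identity int B <-> forall k : comPzRingType, has_mul_identity k B).
Proof.
have conn_id (k : pzRingType) : lrb_connected R B -> has_mul_identity k B.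
  move=> /lrb_connectedP conn; have [e er] := lrb_right_identity B k.
  exists e; split; last exact: sgalg_right_id.
  exact/sgalg_left_idP/connected_left_identity.
have id_conn : has_mul_identity int B -> lrb_connected R B.
  move=> [e [/sgalg_left_idP el _]]; apply/lrb_connectedP => c p.
  exact: left_identity_connected el.
split; first by split=> [/conn_id|/id_conn].
by split=> [/id_conn conn k|id_all]; [exact: conn_id|exact: id_all].
Qed.
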